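(* If $\chi^{-1}(a)$ is not a primitive $n$-th root of unity for any $n\geq 2$, then $\{V_{\lambda}\mid\lambda\in\widehat{G}\}$ is a representative set of isomorphism classes of simple objects in $\mathcal{W}'$.
   Context: $k$ is a field, $G$ a group, $\widehat{G}$ the group of characters $G\to k^{\times}$, $\chi\in\widehat{G}$, and $a\in Z(G)$ with $\chi(a)\neq 1$. $H=kG(\chi^{-1},a,0)$ is the Hopf algebra generated as an algebra by $G$ and $x$ with relations $xg=\chi^{-1}(g)gx$ ($g\in G$), having $k$-basis $\{gx^i\mid g\in G,i\geq 0\}$, with $\Delta(x)=x\otimes a+1\otimes x$, $\varepsilon(x)=0$, $S(x)=-xa^{-1}$, and each $g\in G$ group-like. $H'=H/I$ is a rank one pointed quotient Hopf algebra of $H$, where the Hopf ideal $I$ is as follows: if $\chi^{-1}(a)$ is not a primitive $n$-th root of unity for any $n\geq 2$, then $I=0$ (so $H'=H$); if $\chi^{-1}(a)$ is a primitive $n$-th root of unity with $n\geq 2$, then either $I=\langle x^n\rangle$, or $I=\langle x^n-\beta(1-a^n)\rangle$ with $\beta\in k^{\times}$, $a^n\neq 1$ and $|\chi|=n$. An $H'$-module is the same as an $H$-module $M$ with $I\cdot M=0$. For an $H$-module $M$ and $\lambda\in\widehat{G}$, $M_{(\lambda)}=\{v\in M\mid g\cdot v=\lambda(g)v\ \forall g\in G\}$; $M$ is a weight module if $M=\bigoplus_{\lambda\in\widehat{G}}M_{(\lambda)}$. $\mathcal{W}'$ is the category of all $H'$-modules that are weight modules. $V_{\lambda}$ ($\lambda\in\widehat{G}$)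 is the $1$-dimensional module with $g\cdot v=\lambda(g)v$, $x\cdot v=0$. *)

(* Defs.v *)
From HB Require Import structures.
From mathcomp Require Import all_boot all_order all_algebra.
From mathcomp Require Import finmap.
From mathcomp.multinomials Require Import monalg.

Set Implicit Arguments.
Unset Strict Implicit.
Unset Printing Implicit Defensive.

Import GRing.Theory.
Local Open Scope ring_scope.
#[local] Obligation Tactic := idtac.

Lemma linear_fun0 (k : fieldType) (V W : lmodType k) (f : V -> W) :
  linear f -> f 0 = 0.
Proof.
by move=> fl; have := fl (-1) 0 0; rewrite scaler0 addr0 scaleN1r addNr.
Qed.

Lemma linear_funD (k : fieldType) (V W : lmodType k) (f : V -> W) u v :
  linear f -> f (u + v) = f u + f v.
Proof. by move=> fl; rewrite -[u]scale1r fl !scale1r. Qed.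

Lemma linear_funZ (k : fieldType) (V W : lmodType k) (f : V -> W) c v :
  linear f -> f (c *: v) = c *: f v.
Proof. by move=> fl; rewrite -[c *: v]addr0 fl linear_fun0 ?addr0. Qed.

(** Linear extension to [{malg k[K]}], the vector space with basis [K], of a
    map given on the basis *)

Section MalgBasis.
Context {k : fieldType} {K : choiceType}.
Implicit Types (f g u v : {malg k[K]}).

Definition basis (b : K) : {malg k[K]} := mkmalgU b 1.

Lemma malg_basisE f : f = \sum_(b <- msupp f) mcoeff b f *: basis b.
Proof.
rewrite {1}[f]monalgE; apply: eq_bigr => b _.
by apply/malgP => c; rewrite mcoeffZ !mcoeffU mulrnAr mulr1.
Qed.

Lemma malg_ind (P : {malg k[K]} -> Prop) :
  P 0 -> (forall c u v, P u -> P v -> P (c *: u + v)) ->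
  (forall b, P (basis b)) -> forall f, P f.
Proof.
move=> P0 PD Pb f; rewrite [f]malg_basisE.
by elim/big_rec: _ => // b g _ Pg; apply: PD.
Qed.

End MalgBasis.

HB.lock Definition lext (k : fieldType) (K : choiceType) (V : lmodType k)
    (h : K -> V) (f : {malg k[K]}) : V :=
  \sum_(b <- msupp f) mcoeff b f *: h b.

Section LinearExtension.
Context {k : fieldType} {K : choiceType} {V : lmodType k}.
Implicit Types f g : {malg k[K]}.

Lemma lextE (h : K -> V) f : lext h f = \sum_(b <- msupp f) mcoeff b f *: h b.
Proof. by rewrite lext.unlock. Qed.

Lemma lextEw (h : K -> V) f (d : {fset K}) : (msupp f `<=` d)%fset ->
  lext h f = \sum_(b <- d) mcoeff b f *: h b.
Proof.
move=> le_fd; rewrite lextE (big_fset_incl _ le_fd) //= => b _ bNf.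
by rewrite mcoeff_outdom // scale0r.
Qed.

Lemma lext_is_linear (h : K -> V) : linear (lext h).
Proof.
move=> c f g.
pose d := (msupp f `|` msupp g `|` msupp (c *: f + g))%fset.
have sd : (msupp (c *: f + g) `<=` d)%fset by rewrite fsubsetUr.
have sf : (msupp f `<=` d)%fset by rewrite /d -fsetUA fsubsetUl.
have sg : (msupp g `<=` d)%fset by rewrite /d fsetUAC fsubsetUr.
rewrite (lextEw h sd) (lextEw h sf) (lextEw h sg).
rewrite scaler_sumr -big_split /=; apply: eq_bigr => b _.
by rewrite mcoeffD mcoeffZ scalerDl scalerA.
Qed.
HB.instance Definition _ (h : K -> V) :=
  GRing.isLinear.Build k {malg k[K]} V *:%R (lext h) (lext_is_linear h).

Lemma lextU (h : K -> V) b : lext h (basis b) = h b.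
Proof.
by rewrite lextE /basis msuppU oner_eq0 big_seq_fset1 mcoeffUU scale1r.
Qed.

Lemma eq_lext (h1 h2 : K -> V) : h1 =1 h2 -> lext h1 =1 lext h2.
Proof. by move=> eqh f; rewrite !lextE; apply: eq_bigr => b _; rewrite eqh. Qed.

Lemma lextD (h1 h2 : K -> V) f : lext (fun b => h1 b + h2 b) f = lext h1 f + lext h2 f.
Proof. by rewrite !lextE -big_split; apply: eq_bigr => b _; rewrite scalerDr. Qed.

Lemma lextZ c (h : K -> V) f : lext (fun b => c *: h b) f = c *: lext h f.
Proof.
by rewrite !lextE scaler_sumr; apply: eq_bigr => b _; rewrite !scalerA mulrC.
Qed.

End LinearExtension.

(** Twisted monoid algebras: the algebra with basis a monoid [T] and product
    [b . c = tw b c * (bc)] for a normalised 2-cocycle [tw] *)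

Record twMonoid (k : fieldType) := TwMonoid {
  tw_sort :> choiceType;
  tw_one : tw_sort;
  tw_mul : tw_sort -> tw_sort -> tw_sort;
  tw : tw_sort -> tw_sort -> k;
  tw_mulA : associative tw_mul;
  tw_mul1 : left_id tw_one tw_mul;
  tw_1mul : right_id tw_one tw_mul;
  tw1l : forall b, tw tw_one b = 1;
  tw1r : forall b, tw b tw_one = 1;
  twA : forall b c d,
    tw b c * tw (tw_mul b c) d = tw c d * tw b (tw_mul c d)
}.

Definition twAlg (k : fieldType) (T : twMonoid k) : Type := {malg k[T]}.

Section TwistedAlgebra.
Context {k : fieldType} (T : twMonoid k).
Local Notation A := (twAlg T).

HB.instance Definition _ := GRing.Lmodule.on A.

Definition twB (b : T) : A := basis b.

Lemma twAlg_ind (P : A -> Prop) :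
  P 0 -> (forall c u v, P u -> P v -> P (c *: u + v)) ->
  (forall b, P (twB b)) -> forall f, P f.
Proof. exact: malg_ind. Qed.

Lemma twAlg_eq_linear (V : lmodType k) (p q : A -> V) :
  linear p -> linear q -> (forall b, p (twB b) = q (twB b)) -> p =1 q.
Proof.
move=> pl ql pq; elim/twAlg_ind => [|c u v IHu IHv|b] //.
  by rewrite !linear_fun0.
by rewrite pl ql IHu IHv.
Qed.

Definition twAlg_mul (f g : A) : A :=
  lext (fun b => lext (fun c => tw b c *: twB (tw_mul b c)) g) f.

Lemma twAlg_mulDl : left_distributive twAlg_mul +%R.
Proof. by move=> f g h; rewrite /twAlg_mul linearD. Qed.

Lemma twAlg_mulDr : right_distributive twAlg_mul +%R.
Proof.
move=> f g h; rewrite /twAlg_mul -lextD.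
by apply: eq_lext => b; rewrite linearD.
Qed.

Lemma twAlg_mulZl c (f g : A) : c *: twAlg_mul f g = twAlg_mul (c *: f) g.
Proof. by rewrite /twAlg_mul linearZ. Qed.

Lemma twAlg_mulZr c (f g : A) : c *: twAlg_mul f g = twAlg_mul f (c *: g).
Proof.
rewrite /twAlg_mul -lextZ.
by apply: eq_lext => b; rewrite linearZ.
Qed.

Lemma twAlg_mulBB b c :
  twAlg_mul (twB b) (twB c) = tw b c *: twB (tw_mul b c).
Proof. by rewrite /twAlg_mul !lextU. Qed.

Lemma twAlg_mul_linearl g : linear (twAlg_mul^~ g).
Proof. by move=> c u v /=; rewrite twAlg_mulDl -twAlg_mulZl. Qed.

Lemma twAlg_mul_linearr f : linear (twAlg_mul f).
Proof. by move=> c u v; rewrite twAlg_mulDr -twAlg_mulZr. Qed.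

Lemma twAlg_mul1 : left_id (twB (tw_one T)) twAlg_mul.
Proof.
apply: twAlg_eq_linear => [||b]; [exact: twAlg_mul_linearr | by [] |].
by rewrite twAlg_mulBB tw1l tw_mul1 scale1r.
Qed.

Lemma twAlg_1mul : right_id (twB (tw_one T)) twAlg_mul.
Proof.
apply: twAlg_eq_linear => [||b]; [exact: twAlg_mul_linearl | by [] |].
by rewrite twAlg_mulBB tw1r tw_1mul scale1r.
Qed.

Lemma twAlg_mulA : associative twAlg_mul.
Proof.
move=> f g h.
apply: (twAlg_eq_linear (p := fun f => twAlg_mul f (twAlg_mul g h))
  (q := fun f => twAlg_mul (twAlg_mul f g) h)) => [||b].
- exact: twAlg_mul_linearl.
- by move=> c u v; rewrite !twAlg_mul_linearl.
apply: (twAlg_eq_linear (p := fun g => twAlg_mul (twB b) (twAlg_mul g h))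
  (q := fun g => twAlg_mul (twAlg_mul (twB b) g) h)) => [||c].
- by move=> c u v; rewrite twAlg_mul_linearl twAlg_mul_linearr.
- by move=> c u v; rewrite twAlg_mul_linearr twAlg_mul_linearl.
apply: (twAlg_eq_linear
  (p := fun h => twAlg_mul (twB b) (twAlg_mul (twB c) h))
  (q := fun h => twAlg_mul (twAlg_mul (twB b) (twB c)) h)) => [||d].
- by move=> d u v; rewrite !twAlg_mul_linearr.
- exact: twAlg_mul_linearr.
rewrite !twAlg_mulBB -twAlg_mulZr -twAlg_mulZl !twAlg_mulBB !scalerA.
by rewrite tw_mulA twA.
Qed.

Lemma twAlg_oner_neq0 : twB (tw_one T) != 0.
Proof. by rewrite monalgU_eq0 oner_eq0. Qed.

HB.instance Definition _ := GRing.Zmodule_isNzRing.Build A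
  twAlg_mulA twAlg_mul1 twAlg_1mul twAlg_mulDl twAlg_mulDr twAlg_oner_neq0.
HB.instance Definition _ := GRing.Lmodule_isLalgebra.Build k A twAlg_mulZl.
HB.instance Definition _ := GRing.Lalgebra_isAlgebra.Build k A twAlg_mulZr.

Lemma twBM b c : twB b * twB c = tw b c *: twB (tw_mul b c).
Proof. exact: twAlg_mulBB. Qed.

Lemma twB1 : twB (tw_one T) = 1.
Proof. by []. Qed.

End TwistedAlgebra.

Section TwLext.
Context {k : fieldType} (T : twMonoid k) (B : algType k).

Lemma lext_mul (h : T -> B) :
    (forall b c, h b * h c = tw b c *: h (tw_mul b c)) ->
  {morph (lext h : twAlg T -> B) : f g / f * g}.
Proof.
move=> hM f g; pose m (u v : twAlg T) : twAlg T := u * v.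
have ml v : linear (m^~ v) by move=> c u w; rewrite /m mulrDl scalerAl.
have mr u : linear (m u) by move=> c v w; rewrite /m mulrDr scalerAr.
have hl := lext_is_linear h.
apply: (twAlg_eq_linear (p := fun f => lext h (m f g))
  (q := fun f => lext h f * lext h g)) => [||b].
- by move=> c u v; rewrite ml hl.
- by move=> c u v; rewrite hl mulrDl scalerAl.
apply: (twAlg_eq_linear (p := fun g => lext h (m (twB b) g))
  (q := fun g => lext h (twB b) * lext h g)) => [||c].
- by move=> c u v; rewrite mr hl.
- by move=> c u v; rewrite hl mulrDr scalerAr.
by rewrite /m twBM linearZ /= !lextU hM.
Qed.

End TwLext.

(** The tensor product of twisted monoid algebras, realised on the basis of
    pairs of basis vectors *)

Section Tensor.
Context {k : fieldType}.

Program Definition twTensor (T U : twMonoid k) : twMonoid k :=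
  @TwMonoid k (T * U)%type (tw_one T, tw_one U)
    (fun b c => (tw_mul b.1 c.1, tw_mul b.2 c.2))
    (fun b c => tw b.1 c.1 * tw b.2 c.2) _ _ _ _ _ _.
Next Obligation. by move=> T U [? ?] [? ?] [? ?] /=; rewrite !tw_mulA. Qed.
Next Obligation. by move=> T U [? ?] /=; rewrite !tw_mul1. Qed.
Next Obligation. by move=> T U [? ?] /=; rewrite !tw_1mul. Qed.
Next Obligation. by move=> T U [? ?] /=; rewrite !tw1l mulr1. Qed.
Next Obligation. by move=> T U [? ?] /=; rewrite !tw1r mulr1. Qed.
Next Obligation.
by move=> T U [? ?] [? ?] [? ?] /=; rewrite mulrACA !twA mulrACA.
Qed.

Context (T U : twMonoid k).

Definition tens (f : twAlg T) (g : twAlg U) : twAlg (twTensor T U) :=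
  lext (fun b => lext (fun c => twB (T := twTensor T U) (b, c)) g) f.

Lemma tens_linearl g : linear (tens^~ g).
Proof. by move=> c u v; rewrite /tens linearP. Qed.

Lemma tens_linearr f : linear (tens f).
Proof.
move=> c u v; rewrite /tens -lextZ -lextD.
by apply: eq_lext => b; rewrite linearP.
Qed.

Lemma tensBB b c : tens (twB b) (twB c) = twB (T := twTensor T U) (b, c).
Proof. by rewrite /tens !lextU. Qed.

Lemma tens11 : tens 1 1 = 1.
Proof. by rewrite -!twB1 tensBB. Qed.

(** The linear map on the tensor product induced by a bilinear map *)
Definition tlift (V : lmodType k) (F : twAlg T -> twAlg U -> V)
    (w : twAlg (twTensor T U)) : V :=
  lext (fun b : twTensor T U => F (twB b.1) (twB b.2)) w.

Lemma tlift_linear (V : lmodType k) (F : twAlg T -> twAlg U -> V) :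
  linear (tlift F).
Proof. exact: lext_is_linear. Qed.

Lemma tlift_tens (V : lmodType k) (F : twAlg T -> twAlg U -> V) :
    (forall g, linear (F^~ g)) -> (forall f, linear (F f)) ->
  forall f g, tlift F (tens f g) = F f g.
Proof.
move=> Fl Fr f g.
apply: (twAlg_eq_linear (p := fun f => tlift F (tens f g))
  (q := fun f => F f g)) => [||b].
- by move=> c u v; rewrite (tens_linearl g c u v) (tlift_linear F c).
- exact: Fl.
apply: (twAlg_eq_linear (p := fun g => tlift F (tens (twB b) g))
  (q := fun g => F (twB b) g)) => [||c].
- by move=> c u v; rewrite (tens_linearr _ c u v) (tlift_linear F c).
- exact: Fr.
by rewrite tensBB /tlift lextU.
Qed.

End Tensor.
Arguments twTensor {k} T U.
Arguments tens {k T U} f g.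

(** The characters [G -> k^x], as non-vanishing functions to [k] *)
Record character (k : fieldType) (G : groupType) := Character {
  char_val :> G -> k;
  char_neq0 : forall g, char_val g != 0;
  charM : forall g h, char_val (g * h)%g = char_val g * char_val h
}.

Section Characters.
Context {k : fieldType} {G : groupType}.
Implicit Types chi : character k G.

Lemma char1 chi : chi 1%g = 1.
Proof.
by apply: (mulfI (char_neq0 chi 1%g)); rewrite -charM mulg1 mulr1.
Qed.

Lemma charV chi g : chi (g^-1)%g = (chi g)^-1.
Proof.
apply: (mulfI (char_neq0 chi g)).
by rewrite -charM mulgV char1 divff ?char_neq0.
Qed.

Program Definition char_inv chi : character k G :=
  @Character k G (fun g => (chi g)^-1) _ _.
Next Obligation. by move=> chi g /=; rewrite invr_eq0 char_neq0. Qed.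
Next Obligation. by move=> chi g h /=; rewrite charM invfM. Qed.

(** [chi] has order [n] in the group of characters *)
Definition char_order chi (n : nat) : Prop :=
  [/\ (0 < n)%N, forall g, chi g ^+ n = 1
    & forall m, (0 < m < n)%N -> exists g, chi g ^+ m != 1].

End Characters.

(** The algebra underlying the Hopf algebra [kG(chi^-1, a, 0)]: the basis
    vector [g x^i] is encoded by [(g, i)]. The element [a] enters only the
    comultiplication and the antipode, so it is not a parameter of [kGx]. *)

Section HopfAlgebra.
Context {k : fieldType} {G : groupType} (chi : character k G).

(** [(g x^i)(h x^j) = chi^-1(h)^i (gh) x^(i+j)] *)
Program Definition kGx_monoid : twMonoid k :=
  @TwMonoid k (G * nat)%type (1%g, 0%N)
    (fun b c => ((b.1 * c.1)%g, (b.2 + c.2)%N))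
    (fun b c => char_inv chi c.1 ^+ b.2) _ _ _ _ _ _.
Next Obligation. by move=> [? ?] [? ?] [? ?] /=; rewrite mulgA addnA. Qed.
Next Obligation. by move=> [? ?] /=; rewrite mul1g. Qed.
Next Obligation. by move=> [? ?] /=; rewrite mulg1 addn0. Qed.
Next Obligation. by move=> [? ?] /=; rewrite expr0. Qed.
Next Obligation. by move=> [? ?] /=; rewrite char1 invr1 expr1n. Qed.
Next Obligation.
move=> [b i] [c j] [d l] /=.
by rewrite charM invfM exprMn exprD mulrA mulrC.
Qed.

Definition kGx := twAlg kGx_monoid.
HB.instance Definition _ := GRing.Algebra.on kGx.

Definition gr (g : G) : kGx := @twB k kGx_monoid (g, 0%N).
Definition xx : kGx := @twB k kGx_monoid (1%g, 1%N).

Lemma gr1 : gr 1%g = 1.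
Proof. by []. Qed.

Lemma grM g h : gr (g * h)%g = gr g * gr h.
Proof. by rewrite /gr [RHS]twBM /= expr0 scale1r. Qed.

Lemma xx_gr g : xx * gr g = char_inv chi g *: (gr g * xx).
Proof.
have -> : gr g * xx = @twB k kGx_monoid (g, 1%N).
  by rewrite [LHS]twBM /= expr0 scale1r mulg1.
by rewrite [LHS]twBM /= expr1 mul1g addn0.
Qed.

Lemma gr_xxE g i : gr g * xx ^+ i = @twB k kGx_monoid (g, i).
Proof.
elim: i => [|i IH]; first by rewrite expr0 mulr1.
rewrite exprSr mulrA IH [LHS]twBM /= char1 invr1 expr1n scale1r.
by rewrite mulg1 addn1.
Qed.

(** [kGx] is presented by the generators [gr g], [xx] and the relations
    [grM], [gr1], [xx_gr] *)
Definition kGx_lift (A : algType k) (f : G -> A) (y : A) : kGx -> A :=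
  lext (fun b : kGx_monoid => f b.1 * y ^+ b.2).

Section Lift.
Context {A : algType k} (f : G -> A) (y : A).
Context (f1 : f 1%g = 1) (fM : forall g h, f (g * h)%g = f g * f h).
Context (yf : forall g, y * f g = char_inv chi g *: (f g * y)).

Lemma kGx_lift_linear : linear (kGx_lift f y).
Proof. exact: lext_is_linear. Qed.

Lemma kGx_lift_gr g : kGx_lift f y (gr g) = f g.
Proof. by rewrite /kGx_lift lextU expr0 mulr1. Qed.

Lemma kGx_lift_xx : kGx_lift f y xx = y.
Proof. by rewrite /kGx_lift lextU f1 expr1 mul1r. Qed.

Lemma kGx_lift1 : kGx_lift f y 1 = 1.
Proof. by rewrite -gr1 kGx_lift_gr. Qed.

Lemma kGx_liftM u v : kGx_lift f y (u * v) = kGx_lift f y u * kGx_lift f y v.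
Proof.
have yXf i g : y ^+ i * f g = char_inv chi g ^+ i *: (f g * y ^+ i).
  elim: i => [|i IH]; first by rewrite !expr0 mul1r mulr1 scale1r.
  rewrite [in LHS]exprSr -mulrA yf -scalerAr [y ^+ i * _]mulrA IH -scalerAl.
  by rewrite scalerA -mulrA -exprSr -exprS.
apply: lext_mul => -[g i] [h j] /=.
by rewrite mulrA -(mulrA _ (y ^+ i)) yXf -scalerAr -!scalerAl fM exprD !mulrA.
Qed.

Lemma kGx_lift_unique (p : kGx -> A) :
  linear p -> {morph p : u v / u * v} -> (forall g, p (gr g) = f g) ->
  p xx = y -> p =1 kGx_lift f y.
Proof.
move=> pl pM pg px; apply: twAlg_eq_linear => // [|[g i]].
  exact: kGx_lift_linear.
rewrite -gr_xxE pM /kGx_lift; rewrite gr_xxE lextU pg; congr (_ * _).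
elim: i => [|i IH]; first by rewrite !expr0 -gr1 pg f1.
by rewrite !exprS pM IH px.
Qed.

End Lift.
End HopfAlgebra.

Section TensorAlgebra.
Context {k : fieldType} (T U : twMonoid k).
Local Notation TU := (twAlg (twTensor T U)).

Lemma tensM (f f' : twAlg T) (g g' : twAlg U) :
  tens f g * tens f' g' = tens (f * f') (g * g') :> TU.
Proof.
have tl := @tens_linearl k T U; have tr := @tens_linearr k T U.
apply: (twAlg_eq_linear (p := fun f => tens f g * tens f' g' : TU)
  (q := fun f => tens (f * f') (g * g'))) => [||b].
- by move=> c u v; rewrite tl mulrDl scalerAl.
- by move=> c u v; rewrite mulrDl -scalerAl tl.
apply: (twAlg_eq_linear (p := fun g => tens (twB b) g * tens f' g' : TU)
  (q := fun g => tens (twB b * f') (g * g'))) => [||c].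
- by move=> c u v; rewrite tr mulrDl scalerAl.
- by move=> c u v; rewrite mulrDl -scalerAl tr.
apply: (twAlg_eq_linear
  (p := fun f' => tens (twB b) (twB c) * tens f' g' : TU)
  (q := fun f' => tens (twB b * f') (twB c * g'))) => [||b'].
- by move=> d u v; rewrite tl mulrDr scalerAr.
- by move=> d u v; rewrite mulrDr -scalerAr tl.
apply: (twAlg_eq_linear
  (p := fun g' => tens (twB b) (twB c) * tens (twB b') g' : TU)
  (q := fun g' => tens (twB b * twB b') (twB c * g'))) => [||c'].
- by move=> d u v; rewrite tr mulrDr scalerAr.
- by move=> d u v; rewrite mulrDr -scalerAr tr.
rewrite !tensBB !twBM /= (linear_funZ _ _ (tl _)) (linear_funZ _ _ (tr _)).
by rewrite tensBB scalerA.
Qed.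

Lemma tens_sumP (V : lmodType k) (p q : TU -> V) :
  linear p -> linear q -> (forall f g, p (tens f g) = q (tens f g)) -> p =1 q.
Proof. by move=> pl ql pq; apply: twAlg_eq_linear => // -[b c]; rewrite -tensBB. Qed.

Lemma tlift_mul (A : algType k) (p : twAlg T -> A) (q : twAlg U -> A) :
  linear p -> linear q -> {morph p : f g / f * g} -> {morph q : f g / f * g} ->
  (forall f g, p f * q g = q g * p f) ->
  {morph tlift (fun f g => p f * q g) : u v / u * v}.
Proof.
move=> pl ql pM qM pq u v.
have Fl g : linear (fun f => p f * q g).
  by move=> c f f' /=; rewrite pl mulrDl scalerAl.
have Fr f : linear (fun g => p f * q g).
  by move=> c g g' /=; rewrite ql mulrDr scalerAr.
have tl := tlift_linear (fun f g => p f * q g).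
apply: (tens_sumP (p := fun u => tlift (fun f g => p f * q g) (u * v))
  (q := fun u => tlift (fun f g => p f * q g) u *
                 tlift (fun f g => p f * q g) v)) => [||f g].
- by move=> c w w'; rewrite mulrDl -scalerAl tl.
- by move=> c w w'; rewrite tl mulrDl scalerAl.
apply: (tens_sumP
  (p := fun v => tlift (fun f g => p f * q g) (tens f g * v))
  (q := fun v => tlift (fun f g => p f * q g) (tens f g) *
                 tlift (fun f g => p f * q g) v)) => [||f' g'].
- by move=> c w w'; rewrite mulrDr -scalerAr tl.
- by move=> c w w'; rewrite tl mulrDr scalerAr.
have tE f0 g0 := tlift_tens Fl Fr f0 g0.
rewrite tensM (tE (f * f') (g * g')) (tE f g) (tE f' g') pM qM.
by rewrite -!mulrA; congr (_ * _); rewrite !mulrA pq.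
Qed.

End TensorAlgebra.

Section HopfStructure.
Context {k : fieldType} {G : groupType} (chi : character k G) (a : G).
Local Notation H := (kGx chi).
Local Notation M := (kGx_monoid chi).
Local Notation HH := (twAlg (twTensor M M)).
Local Notation HHH := (twAlg (twTensor M (twTensor M M))).

Definition comul : H -> HH :=
  kGx_lift (A := HH) (fun g => tens (gr chi g) (gr chi g))
    (tens (xx chi) (gr chi a) + tens 1 (xx chi)).

Definition counit : H -> k := kGx_lift (A := k^o) (fun=> 1) 0.

(** [S(g x^i) = S(x)^i S(g)] *)
Definition antipode : H -> H :=
  lext (fun b : M => (- (xx chi * gr chi a^-1)) ^+ b.2 * gr chi (b.1)^-1).

Lemma comul_linear : linear comul.
Proof. exact: kGx_lift_linear. Qed.

Lemma counit_linear : linear (counit : H -> k^o).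
Proof. exact: kGx_lift_linear. Qed.

Lemma antipode_linear : linear antipode.
Proof. exact: lext_is_linear. Qed.

Lemma comul_gr g : comul (gr chi g) = tens (gr chi g) (gr chi g).
Proof. exact: kGx_lift_gr. Qed.

Lemma comul_xx : comul (xx chi) = tens (xx chi) (gr chi a) + tens 1 (xx chi).
Proof. by apply: kGx_lift_xx; rewrite gr1 tens11. Qed.

Lemma counit_gr g : counit (gr chi g) = 1.
Proof. exact: (@kGx_lift_gr k G chi k^o). Qed.

Lemma counit_xx : counit (xx chi) = 0.
Proof. exact: (@kGx_lift_xx k G chi k^o). Qed.

Lemma counitM u v : counit (u * v) = counit u * counit v.
Proof.
apply: (@kGx_liftM k G chi k^o) => [g h|g]; first by rewrite mulr1.
by rewrite mul0r mulr0 scaler0.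
Qed.

Lemma antipode_gr g : antipode (gr chi g) = gr chi g^-1.
Proof. by rewrite /antipode lextU expr0 mul1r. Qed.

Lemma antipode_xx : antipode (xx chi) = - (xx chi * gr chi a^-1).
Proof. by rewrite /antipode lextU expr1 invg1 gr1 mulr1. Qed.

Lemma kGx_eq_linear_r (V : lmodType k) (p q : H -> V) :
  linear p -> linear q -> (forall g, p (gr chi g) = q (gr chi g)) ->
  (forall u, p u = q u -> p (u * xx chi) = q (u * xx chi)) -> p =1 q.
Proof.
move=> pl ql pg px; apply: twAlg_eq_linear => // -[g i].
rewrite -gr_xxE; elim: i => [|i IH]; first by rewrite mulr1.
by rewrite exprSr mulrA px.
Qed.

Context (central_a : forall g, (a * g = g * a)%g).

Lemma comulM u v : comul (u * v) = comul u * comul v.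
Proof.
apply: kGx_liftM => [g h|g]; first by rewrite tensM -grM.
have tl := @tens_linearl k M M; have tr := @tens_linearr k M M.
rewrite mulrDl mulrDr !tensM !xx_gr mul1r mulr1.
rewrite -(grM chi a g) -(grM chi g a) central_a.
by rewrite (linear_funZ _ _ (tl _)) (linear_funZ _ _ (tr _)) scalerDr.
Qed.

Lemma antipodeM u v : antipode (u * v) = antipode v * antipode u.
Proof.
have Sl := antipode_linear.
apply: (twAlg_eq_linear (p := fun u : H => antipode (u * v))
  (q := fun u : H => antipode v * antipode u)) => [||[g i]].
- by move=> c w w'; rewrite mulrDl -scalerAl Sl.
- by move=> c w w'; rewrite Sl mulrDr scalerAr.
apply: (twAlg_eq_linear (p := fun v : H => antipode (twB (T := M) (g, i) * v))
  (q := fun v : H => antipode v * antipode (twB (T := M) (g, i))))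
  => [||[h j]].
- by move=> c w w'; rewrite mulrDr -scalerAr Sl.
- by move=> c w w'; rewrite Sl mulrDl scalerAl.
rewrite twBM (linear_funZ _ _ Sl) /antipode !lextU /=.
set y := - (xx chi * _).
have yg e : y * gr chi e^-1 = chi e *: (gr chi e^-1 * y).
  rewrite /y mulNr mulrN scalerN -mulrA -grM -invgM -central_a invgM grM.
  by rewrite !mulrA xx_gr /= charV invrK -scalerAl.
have yXg n e : y ^+ n * gr chi e^-1 = chi e ^+ n *: (gr chi e^-1 * y ^+ n).
  elim: n => [|n IH]; first by rewrite !expr0 mul1r mulr1 scale1r.
  rewrite [in LHS]exprSr -mulrA yg -scalerAr [y ^+ n * _]mulrA IH -scalerAl.
  by rewrite scalerA -mulrA -exprSr -exprS.
rewrite invgM grM addnC exprD -!mulrA [y ^+ i * (gr chi h^-1 * _)]mulrA. rewrite (yXg i h).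
rewrite -scalerAl -scalerAr scalerA -exprMn mulVf ?char_neq0 // expr1n scale1r.
by rewrite !mulrA.
Qed.

Definition tassoc : twAlg (twTensor (twTensor M M) M) -> HHH :=
  lext (fun b : twTensor (twTensor M M) M =>
    twB (T := twTensor M (twTensor M M)) (b.1.1, (b.1.2, b.2))).

Lemma tassoc_tens (f g h : H) :
  tassoc (tens (tens f g) h) = tens f (tens g h).
Proof.
have tl := @tens_linearl k; have tr := @tens_linearr k.
have al : linear tassoc by exact: lext_is_linear.
apply: (twAlg_eq_linear (p := fun f : H => tassoc (tens (tens f g) h))
  (q := fun f : H => tens f (tens g h))) => [||b].
- by move=> c u v; rewrite !tl al.
- exact: tl.
apply: (twAlg_eq_linear
  (p := fun g : H => tassoc (tens (tens (twB b : H) g) h))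
  (q := fun g : H => tens (twB b : H) (tens g h))) => [||b'].
- by move=> c u v; rewrite tr tl al.
- by move=> c u v; rewrite tl tr.
apply: (twAlg_eq_linear
  (p := fun h : H => tassoc (tens (tens (twB b : H) (twB b' : H)) h))
  (q := fun h : H => tens (twB b : H) (tens (twB b' : H) h))) => [||b''].
- by move=> c u v; rewrite tr al.
- by move=> c u v; rewrite !tr.
by rewrite !tensBB /tassoc lextU.
Qed.

Lemma tassocM : {morph tassoc : u v / u * v}.
Proof.
apply: lext_mul => -[[b1 b2] b3] [[c1 c2] c3] /=.
by rewrite twBM /= mulrA.
Qed.

(** [tens], [comul], [counit] and [antipode] satisfy the Hopf algebra axioms;
    [tassoc] identifies [(H (x) H) (x) H] with [H (x) (H (x) H)]. *)

Lemma coassociative u :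
  tassoc (tlift (fun f g => tens (comul f) g) (comul u)) =
  tlift (fun f g => tens f (comul g)) (comul u).
Proof.
have cl := comul_linear; have al : linear tassoc by exact: lext_is_linear.
have tl := @tens_linearl k; have tr := @tens_linearr k.
pose D1 (w : HH) := tassoc (tlift (fun f g => tens (comul f) g) w).
pose D2 (w : HH) : HHH := tlift (fun f g => tens f (comul g)) w.
have D1l : linear D1 by move=> c w w'; rewrite /D1 tlift_linear al.
have D2l : linear D2 by move=> c w w'; rewrite /D2 tlift_linear.
have D1t f g : D1 (tens f g) = tassoc (tens (comul f) g).
  rewrite /D1 tlift_tens // => [h c w w'|h]; last exact: tr.
  by rewrite cl tl.
have D2t f g : D2 (tens f g) = tens f (comul g).
  rewrite /D2 tlift_tens // => [h|h c w w']; first exact: tl.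
  by rewrite cl tr.
have D1M : {morph D1 : w w' / w * w'}.
  move=> w w'; apply: (tens_sumP (p := fun w => D1 (w * w'))
    (q := fun w => D1 w * D1 w')) => [||f g].
  - by move=> c v v'; rewrite mulrDl -scalerAl D1l.
  - by move=> c v v'; rewrite D1l mulrDl scalerAl.
  apply: (tens_sumP (p := fun w' => D1 (tens f g * w'))
    (q := fun w' => D1 (tens f g) * D1 w')) => [||f' g'].
  - by move=> c v v'; rewrite mulrDr -scalerAr D1l.
  - by move=> c v v'; rewrite D1l mulrDr scalerAr.
  by rewrite tensM !D1t -tassocM tensM comulM.
have D2M : {morph D2 : w w' / w * w'}.
  move=> w w'; apply: (tens_sumP (p := fun w => D2 (w * w'))
    (q := fun w => D2 w * D2 w')) => [||f g].
  - by move=> c v v'; rewrite mulrDl -scalerAl D2l.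
  - by move=> c v v'; rewrite D2l mulrDl scalerAl.
  apply: (tens_sumP (p := fun w' => D2 (tens f g * w'))
    (q := fun w' => D2 (tens f g) * D2 w')) => [||f' g'].
  - by move=> c v v'; rewrite mulrDr -scalerAr D2l.
  - by move=> c v v'; rewrite D2l mulrDr scalerAr.
  by rewrite tensM !D2t tensM comulM.
rewrite -/(D1 (comul u)) -/(D2 (comul u)).
pose p u := D1 (comul u); pose q u := D2 (comul u).
apply: (kGx_eq_linear_r (p := p) (q := q)) => [||g|v pqv].
- by move=> c w w'; rewrite /p cl D1l.
- by move=> c w w'; rewrite /q cl D2l.
- by rewrite /p /q comul_gr D1t D2t comul_gr tassoc_tens.
rewrite /p /q !comulM D1M D2M -/(p v) -/(q v) pqv; congr (_ * _).
rewrite comul_xx (linear_funD _ _ D1l) (linear_funD _ _ D2l) !D1t !D2t.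
rewrite comul_gr comul_xx -gr1 comul_gr gr1.
rewrite (linear_funD _ _ (tl _ _ _)) (linear_funD _ _ (tr _ _ _)).
by rewrite (linear_funD _ _ al) !tassoc_tens addrA.
Qed.

Lemma tlift_mulr (V : lmodType k) (F : H -> H -> V) (L : V -> V) c d w :
  (forall g, linear (F^~ g)) -> (forall f, linear (F f)) -> linear L ->
  (forall f g, F (f * c) (g * d) = L (F f g)) ->
  tlift F (w * tens c d) = L (tlift F w).
Proof.
move=> Fl Fr Ll FL; have tE := tlift_tens Fl Fr.
apply: (tens_sumP (p := fun w => tlift F (w * tens c d))
  (q := fun w => L (tlift F w))) => [||f g].
- by move=> e v v'; rewrite mulrDl -scalerAl tlift_linear.
- by move=> e v v'; rewrite tlift_linear Ll.
by rewrite tensM (tE (f * c) (g * d)) FL (tE f g).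
Qed.

Lemma tlift_comul_eq (F : H -> H -> H) (L1 L2 : H -> H) (q : H -> H) :
  (forall g, linear (F^~ g)) -> (forall f, linear (F f)) ->
  linear L1 -> linear L2 -> linear q ->
  (forall f g, F (f * xx chi) (g * gr chi a) = L1 (F f g)) ->
  (forall f g, F (f * 1) (g * xx chi) = L2 (F f g)) ->
  (forall g, F (gr chi g) (gr chi g) = q (gr chi g)) ->
  (forall u, q (u * xx chi) = L1 (q u) + L2 (q u)) ->
  forall u, tlift F (comul u) = q u.
Proof.
move=> Fl Fr L1l L2l ql FL1 FL2 Fg qx.
have cl := comul_linear.
apply: (kGx_eq_linear_r (p := fun u => tlift F (comul u)) (q := q))
  => [||g|v IH].
- by move=> c w w'; rewrite cl tlift_linear.
- exact: ql.
- by rewrite comul_gr (tlift_tens Fl Fr).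
rewrite comulM comul_xx mulrDr (linear_funD _ _ (tlift_linear F)) qx -IH.
by congr (_ + _); apply: tlift_mulr.
Qed.

Lemma counit_left u : tlift (fun f g => counit f *: g) (comul u) = u.
Proof.
have el := counit_linear.
apply: (tlift_comul_eq (F := fun f g => counit f *: g) (L1 := fun=> 0)
  (L2 := fun f => f * xx chi) (q := id)) => [g|f||||f g|f g|g|w] //.
- by move=> c v w; rewrite /= el scalerDl scalerA.
- by move=> c v w; rewrite /= scalerDr !scalerA mulrC.
- by move=> c v w; rewrite scaler0 addr0.
- by move=> c v w; rewrite mulrDl scalerAl.
- by rewrite counitM counit_xx mulr0 scale0r.
- by rewrite mulr1 scalerAl.
- by rewrite counit_gr scale1r.
- by rewrite add0r.
Qed.

Lemma counit_right u : tlift (fun f g => counit g *: f) (comul u) = u.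
Proof.
have el := counit_linear.
apply: (tlift_comul_eq (F := fun f g => counit g *: f)
  (L1 := fun f => f * xx chi) (L2 := fun=> 0) (q := id))
  => [g|f||||f g|f g|g|w] //.
- by move=> c v w; rewrite /= scalerDr !scalerA mulrC.
- by move=> c v w; rewrite /= el scalerDl scalerA.
- by move=> c v w; rewrite mulrDl scalerAl.
- by move=> c v w; rewrite scaler0 addr0.
- by rewrite counitM counit_gr mulr1 scalerAl.
- by rewrite counitM counit_xx mulr0 scale0r.
- by rewrite counit_gr scale1r.
- by rewrite addr0.
Qed.

Lemma antipode_left u :
  tlift (fun f g => antipode f * g) (comul u) = counit u *: 1.
Proof.
have el := counit_linear; have Sl := antipode_linear.
apply: (tlift_comul_eq (F := fun f g => antipode f * g)
  (L1 := fun f => antipode (xx chi) * f * gr chi a)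
  (L2 := fun f => f * xx chi) (q := fun u => counit u *: 1))
  => [g|f||||f g|f g|g|w].
- by move=> c v w; rewrite /= Sl mulrDl scalerAl.
- by move=> c v w; rewrite /= mulrDr scalerAr.
- by move=> c v w; rewrite mulrDr mulrDl -scalerAr -scalerAl.
- by move=> c v w; rewrite mulrDl scalerAl.
- by move=> c v w; rewrite el scalerDl scalerA.
- by rewrite antipodeM !mulrA.
- by rewrite mulr1 mulrA.
- by rewrite antipode_gr counit_gr scale1r -grM mulVg gr1.
rewrite counitM counit_xx mulr0 scale0r -scalerAr mulr1 -!scalerAl mul1r.
by rewrite antipode_xx mulNr -mulrA -grM mulVg gr1 mulr1 scalerN addNr.
Qed.

Lemma antipode_right u :
  tlift (fun f g => f * antipode g) (comul u) = counit u *: 1.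
Proof.
have el := counit_linear; have Sl := antipode_linear.
have cl := comul_linear.
pose F (f g : H) : H := f * antipode g.
have Fl g : linear (F^~ g) by move=> c v w; rewrite /F mulrDl scalerAl.
have Fr f : linear (F f) by move=> c v w; rewrite /F Sl mulrDr scalerAr.
pose q (u : H) : H := counit u *: 1.
apply: (kGx_eq_linear_r (p := fun u => tlift F (comul u)) (q := q))
  => [||g|v _].
- by move=> c w w'; rewrite cl tlift_linear.
- by move=> c w w'; rewrite /q el scalerDl scalerA.
- rewrite comul_gr (tlift_tens Fl Fr) /F /q antipode_gr counit_gr scale1r.
  by rewrite -grM mulgV gr1.
rewrite comulM comul_xx /q counitM counit_xx mulr0 scale0r.
apply: (tens_sumP (q := fun=> 0) (p := fun w => tlift F
  (w * (tens (xx chi) (gr chi a) + tens 1 (xx chi))))) => [||f g].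
- by move=> c w w'; rewrite mulrDl -scalerAl tlift_linear.
- by move=> c w w'; rewrite scaler0 addr0.
rewrite mulrDr (linear_funD _ _ (tlift_linear F)) !tensM.
rewrite (tlift_tens Fl Fr (f * xx chi) (g * gr chi a)).
rewrite (tlift_tens Fl Fr (f * 1) (g * xx chi)) /F.
by rewrite !antipodeM antipode_gr antipode_xx mulr1 mulNr mulrN !mulrA subrr.
Qed.

End HopfStructure.

Section Quotient.
Context {k : fieldType} {G : groupType} (chi : character k G) (a : G).
Local Notation H := (kGx chi).

Definition two_sided_ideal (I : H -> Prop) : Prop :=
  [/\ I 0, forall u v, I u -> I v -> I (u + v)
    & forall u v w, I v -> I (u * v * w)].

Definition ideal_gen (y z : H) : Prop :=
  forall J, two_sided_ideal J -> J y -> J z.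

(** [Delta(I)] is contained in [I (x) H + H (x) I], [eps(I) = 0] and
    [S(I)] is contained in [I] *)
Definition hopf_ideal (I : H -> Prop) : Prop :=
  [/\ two_sided_ideal I,
      forall u, I u -> exists n (f g : 'I_n -> H),
        (forall i, I (f i) \/ I (g i)) /\
        comul a u = \sum_(i < n) tens (f i) (g i),
      forall u, I u -> counit u = 0
    & forall u, I u -> I (antipode a u)].

(** The Hopf ideals [I] such that [H' = H/I] is a rank one pointed quotient *)
Variant rank_one_ideal (I : H -> Prop) : Prop :=
  | RankOneZero of
      (forall n, (2 <= n)%N -> ~~ n.-primitive_root (char_inv chi a)) &
      (forall u, I u <-> u = 0)
  | RankOneNilpotent n of (2 <= n)%N &
      n.-primitive_root (char_inv chi a) &
      (forall u, I u <-> ideal_gen (xx chi ^+ n) u)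
  | RankOneNonNilpotent n (beta : k) of (2 <= n)%N &
      n.-primitive_root (char_inv chi a) & beta != 0 &
      (a ^+ n != 1)%g & char_order chi n &
      (forall u, I u <->
        ideal_gen (xx chi ^+ n - beta *: (1 - gr chi (a ^+ n)%g)) u).

End Quotient.

Section WeightModules.
Context {k : fieldType} {G : groupType} {chi : character k G}.
Local Notation H := (kGx chi).

(** The scalars [k] act on an [H]-module through [c |-> c%:A]. *)
Definition weight_vector (M : lmodType H) (lam : character k G) (v : M) :=
  forall g, gr chi g *: v = (lam g)%:A *: v.

(** [M] is the direct sum of its weight spaces; weights are compared as
    functions, [=1]. *)
Definition weight_module (M : lmodType H) : Prop :=
  (forall v : M, exists n (lam : 'I_n -> character k G) (w : 'I_n -> M),
    (forall i, weight_vector (lam i) (w i)) /\ v = \sum_(i < n) w i) /\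
  (forall n (lam : 'I_n -> character k G) (w : 'I_n -> M),
    (forall i j, lam i =1 lam j -> i = j) ->
    (forall i, weight_vector (lam i) (w i)) ->
    \sum_(i < n) w i = 0 -> forall i, w i = 0).

(** Objects of [W']: [H]-modules killed by [I] which are weight modules *)
Definition in_W' (I : H -> Prop) (M : lmodType H) : Prop :=
  (forall u (v : M), I u -> u *: v = 0) /\ weight_module M.

(** Simple objects of [W']: a subobject of [M] is given by an injective
    morphism from an object [N] of [W'] (monomorphisms of [W'] are injective,
    as kernels are again weight modules). *)
Definition simple_object_W' (I : H -> Prop) (M : lmodType H) : Prop :=
  [/\ in_W' I M, exists v : M, v != 0
    & forall (N : lmodType H) (f : {linear N -> M}),
        in_W' I N -> injective f -> (forall v : N, v = 0) \/ bijective f].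

Definition isomorphic_modules (M N : lmodType H) : Prop :=
  exists f : {linear M -> N}, bijective f.

End WeightModules.

(** The 1-dimensional module [V_lam]: see [Vmod_gr] and [Vmod_xx] *)
Definition Vmod (k : fieldType) (G : groupType) (chi lam : character k G) :
  Type := k.

Section OneDimensionalModule.
Context {k : fieldType} {G : groupType} (chi lam : character k G).
Local Notation V := (Vmod chi lam).

HB.instance Definition _ := GRing.Zmodule.on V.

Definition Vmod_eval : kGx chi -> k := kGx_lift (A := k^o) lam 0.

Lemma Vmod_evalM u v : Vmod_eval (u * v) = Vmod_eval u * Vmod_eval v.
Proof.
apply: (@kGx_liftM k G chi k^o lam 0) => [g h|g]; first exact: (charM lam).
by rewrite mul0r mulr0 scaler0.
Qed.

Lemma Vmod_eval1 : Vmod_eval 1 = 1.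
Proof. by rewrite /Vmod_eval -gr1 (@kGx_lift_gr k G chi k^o) char1. Qed.

Definition Vmod_scale (u : kGx chi) (v : V) : V := Vmod_eval u * v.

Lemma Vmod_scalerA u v w :
  Vmod_scale u (Vmod_scale v w) = Vmod_scale (u * v) w.
Proof. by rewrite /Vmod_scale Vmod_evalM mulrA. Qed.

Lemma Vmod_scale1r : left_id 1 Vmod_scale.
Proof. by move=> v; rewrite /Vmod_scale Vmod_eval1 mul1r. Qed.

Lemma Vmod_scalerDr : right_distributive Vmod_scale +%R.
Proof. by move=> u v w; rewrite /Vmod_scale [LHS]mulrDr. Qed.

Lemma Vmod_scalerDl v : {morph Vmod_scale^~ v : u w / u + w}.
Proof.
move=> u w; rewrite /Vmod_scale -[RHS]mulrDl; congr (_ * _).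
exact: (linear_funD _ _ (@kGx_lift_linear k G chi k^o lam 0)).
Qed.

HB.instance Definition _ := GRing.Zmodule_isLmodule.Build (kGx chi) V
  Vmod_scalerA Vmod_scale1r Vmod_scalerDr Vmod_scalerDl.

Lemma Vmod_gr g (v : V) : gr chi g *: v = (lam g * v : k).
Proof.
by rewrite [LHS]/(Vmod_scale _ _) /Vmod_scale /Vmod_eval
  (@kGx_lift_gr k G chi k^o).
Qed.

Lemma Vmod_xx (v : V) : xx chi *: v = 0.
Proof.
rewrite [LHS]/(Vmod_scale _ _) /Vmod_scale /Vmod_eval.
by rewrite (@kGx_lift_xx k G chi k^o) ?mul0r // char1.
Qed.

Lemma Vmod_scalar (c : k) (v : V) : (c%:A : kGx chi) *: v = (c * v : k).
Proof.
rewrite [LHS]/(Vmod_scale _ _) /Vmod_scale.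
have -> : Vmod_eval c%:A = c * Vmod_eval 1.
  exact: (linear_funZ _ _ (@kGx_lift_linear k G chi k^o lam 0)).
by rewrite Vmod_eval1 mulr1.
Qed.

End OneDimensionalModule.

(* Main.v *)
Require Import Defs.
From mathcomp Require Import all_boot all_order all_algebra.
From HB Require Import structures.
From mathcomp Require Import boolp.

Set Implicit Arguments.
Unset Strict Implicit.
Unset Printing Implicit Defensive.

Import GRing.Theory.
Local Open Scope ring_scope.

(** Since [gx = chi(g) xg], the variable [x] sends the weight space of [lam]
    to that of [lam chi]. As [chi^-1(a)] is neither [1] nor a primitive [n]-th
    root of unity with [n >= 2], its powers are pairwise distinct, hence so
    are the weights [lam chi^i]: the vectors [x^i v] obtained from a weight
    vector [v] lie in independent weight spaces. Moreover [I = 0], so that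
    [W'] consists of all weight modules over [H].

    Let [M] be simple and [v] a weight vector of [M]. The group acts on
    each [x^i v] by scalars, so [Hv = k[x]v] is spanned by weight vectors
    and is a subobject of [M] ([cyclic_weight_module]). Applied to the weight
    vector [xv], this leaves two cases. If [H(xv) = M], then [v = p(x) x v]
    for a polynomial [p], so the polynomial [p 'X - 1], whose constant term is
    [-1], annihilates [v]; by independence of the [x^i v] this forces [v = 0]
    ([weight_vector_notin_xx]). Otherwise [H(xv) = 0]. In both cases [xv = 0]
    ([simple_xx0]).

    Consequently a nonzero weight vector [v] of weight [lam] yields an
    embedding [c |-> cv] of [V_lam] in [M], which is onto by simplicity
    ([simple_iso_Vmod]). Conversely each [V_lam] is simple because it is a line
    over [k], and [lam] is recovered from it as its only weight. *)

(** * Weights twisted by powers of a character *)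

(** A relation [z ^+ n = 1] with [n > 0] makes [z] a primitive root of unity of
    some order, and order 1 means [z = 1]. *)
Lemma expr_inj_not_root_of_unity (k : fieldType) (z : k) : z != 0 -> z != 1 ->
  (forall n, (2 <= n)%N -> ~~ n.-primitive_root z) ->
  injective (fun i => z ^+ i).
Proof.
move=> z0 z1 zP.
have zN n : (0 < n)%N -> z ^+ n != 1.
  move=> n0; apply/eqP => zn1.
  have [[|[|m]] mz _] := prim_order_exists n0 zn1.
  - by have := prim_order_gt0 mz.
  - by move/eqP: z1; apply; rewrite -(prim_expr_order mz) expr1.
  - by have := zP m.+2 isT; rewrite mz.
have le_inj i j : (i <= j)%N -> z ^+ i = z ^+ j -> i = j.
  move=> le_ij /esym/eqP; rewrite -(subnKC le_ij) exprD.
  rewrite -[X in _ == X]mulr1 (inj_eq (mulfI _)) ?expf_neq0 //.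
  case: (posnP (j - i)) => [-> _|/zN/negbTE -> //]; by rewrite addn0.
move=> i j /= e; case: (leqP i j) => [/le_inj->//|/ltnW/le_inj e']; exact/esym/e'.
Qed.

Section Characters.
Context {k : fieldType} {G : groupType}.
Implicit Types (chi lam : character k G) (a : G).

Program Definition char_twist lam chi (i : nat) : character k G :=
  @Character k G (fun g => lam g * chi g ^+ i) _ _.
Next Obligation. by rewrite mulf_neq0 ?expf_neq0 ?char_neq0. Qed.
Next Obligation. by rewrite !charM exprMn mulrACA. Qed.

(** Characters are compared by their values at [a] alone. *)
Lemma char_twist_inj lam chi a i j : chi a != 1 ->
  (forall n, (2 <= n)%N -> ~~ n.-primitive_root (char_inv chi a)) ->
  char_twist lam chi i =1 char_twist lam chi j -> i = j.
Proof.
move=> chia noroot /(_ a) /= /(mulfI (char_neq0 lam a)) e.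
apply: (@expr_inj_not_root_of_unity k (char_inv chi a)); rewrite ?char_neq0 //=.
  by rewrite invr_eq1.
by rewrite !exprVn e.
Qed.

End Characters.

(** * Modules over a k-algebra *)

Section AlgebraModules.
Context {k : fieldType} {A : algType k} {M : lmodType A}.
Implicit Types (c d : k) (u : A) (v : M).

(** A module over [A] only carries the scalars of [A]; this is the vector space
    structure restricted along [k -> A]. *)
Definition kscale c v : M := c%:A *: v.

Lemma kscale1 v : kscale 1 v = v.
Proof. by rewrite /kscale !scale1r. Qed.

Lemma kscale0 v : kscale 0 v = 0.
Proof. by rewrite /kscale !scale0r. Qed.

Lemma kscaleN1 v : kscale (-1) v = - v.
Proof. by rewrite /kscale !scaleN1r. Qed.

Lemma kscaleA c d v : kscale c (kscale d v) = kscale (c * d) v.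
Proof. by rewrite /kscale scalerA mulr_algl scalerA. Qed.

Lemma scale_kscale u c v : u *: kscale c v = kscale c (u *: v).
Proof. by rewrite /kscale !scalerA mulr_algl mulr_algr. Qed.

Lemma scalerZ c u v : (c *: u) *: v = kscale c (u *: v).
Proof. by rewrite /kscale scalerA mulr_algl. Qed.

Lemma horner_alg_sum (y : A) v (p : {poly k}) :
  horner_alg y p *: v = \sum_(i < size p) kscale p`_i (y ^+ i *: v).
Proof.
rewrite -{1}[p]coefK poly_def linear_sum scaler_suml; apply: eq_bigr => i _.
by rewrite linearZ /= mulr_algl scalerZ rmorphXn /= horner_algX.
Qed.

(** Moving [z] across one factor [y] costs a factor [c], whence [c ^+ i]. *)
Lemma eigen_expr (z y : A) c d v : z * y = c *: (y * z) -> z *: v = kscale d v ->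
  forall i, z *: (y ^+ i *: v) = kscale (d * c ^+ i) (y ^+ i *: v).
Proof.
move=> zy zv; elim=> [|i IH]; first by rewrite !expr0 scale1r mulr1.
rewrite !exprS -[(y * _) *: v]scalerA scalerA zy scalerZ.
rewrite -[_ *: (y ^+ i *: v)]scalerA IH.
by rewrite scale_kscale kscaleA mulrCA scalerA.
Qed.

End AlgebraModules.

(** * Cyclic modules generated by weight vectors *)

Section WeightVectors.
Context {k : fieldType} {G : groupType} {chi : character k G}.
Local Notation H := (kGx chi).
Context {M : lmodType H}.
Implicit Types (lam : character k G) (u : H) (v w : M).

Lemma weight_vectorZ lam v (c : k) :
  weight_vector lam v -> weight_vector lam (kscale c v).
Proof.
move=> vl g; rewrite [LHS]scale_kscale vl.
by rewrite [LHS]kscaleA mulrC -[LHS]kscaleA.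
Qed.

Lemma weight_xx lam v i :
  weight_vector lam v -> weight_vector (char_twist lam chi i) (xx chi ^+ i *: v).
Proof.
move=> vl g; apply: (eigen_expr _ (vl g)).
by rewrite xx_gr scalerA /= mulfV ?char_neq0 // scale1r.
Qed.

(** The group acts on each [x^i v] by a scalar, so the basis element [g x^i]
    acts on [v] as the monomial [(lam chi^i)(g) 'X^i] evaluated at [x]. *)
Lemma cyclic_polynomial lam v u : weight_vector lam v ->
  exists p : {poly k}, u *: v = horner_alg (xx chi) p *: v.
Proof.
move=> vl.
elim/(@twAlg_ind _ (kGx_monoid chi)): u => [|c u1 u2 [p1 e1] [p2 e2]|[g i]].
- by exists 0; rewrite rmorph0.
- exists (c *: p1 + p2); rewrite linearP /= mulr_algl [LHS]scalerDl [RHS]scalerDl e2.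
  by congr (_ + _); rewrite [LHS]scalerZ [RHS]scalerZ e1.
exists (char_twist lam chi i g *: 'X^i).
rewrite linearZ /= mulr_algl rmorphXn /= horner_algX [RHS]scalerZ.
by rewrite -gr_xxE -[LHS]scalerA (weight_xx _ vl).
Qed.

(** The terms of [p(x) v] have the pairwise distinct weights [lam chi^i]. *)
Lemma weight_polynomial0 (a : G) lam v (p : {poly k}) :
  chi a != 1 ->
  (forall n, (2 <= n)%N -> ~~ n.-primitive_root (char_inv chi a)) ->
  weight_module M -> weight_vector lam v ->
  horner_alg (xx chi) p *: v = 0 -> forall i, kscale p`_i (xx chi ^+ i *: v) = 0.
Proof.
move=> chia noroot [_ Mdir] vl; rewrite [LHS]horner_alg_sum => pv0 i.
case: (ltnP i (size p)) => [ltip|/leq_sizeP ->//]; last exact: kscale0.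
apply: (Mdir _ (fun i : 'I_(size p) => char_twist lam chi i)
  (fun i => kscale p`_i (xx chi ^+ i *: v)) _ _ pv0 (Ordinal ltip)).
  by move=> j l /(char_twist_inj chia noroot) /val_inj.
by move=> j; apply/weight_vectorZ/weight_xx.
Qed.

(** If [v = p(x) x v], then [p 'X - 1] annihilates [v], and its constant term
    alone already gives [v = 0]. *)
Lemma weight_vector_notin_xx (a : G) lam v u :
  chi a != 1 ->
  (forall n, (2 <= n)%N -> ~~ n.-primitive_root (char_inv chi a)) ->
  weight_module M -> weight_vector lam v -> v = u *: (xx chi *: v) -> v = 0.
Proof.
move=> chia noroot Mw vl.
have wx : weight_vector (char_twist lam chi 1) (xx chi *: v).
  by rewrite -[xx chi]expr1; apply: weight_xx.
have [p ->] := cyclic_polynomial u wx => vE.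
have q0 : horner_alg (xx chi) (p * 'X - 1) *: v = 0.
  rewrite rmorphB rmorphM rmorph1 /= horner_algX [LHS]scalerBl [X in _ - X]scale1r.
  by rewrite -[X in X - _]scalerA -vE subrr.
have := weight_polynomial0 chia noroot Mw vl q0 0.
rewrite coefB coefMX coef1 /= expr0 sub0r [LHS]kscaleN1 scale1r.
by move/eqP; rewrite oppr_eq0 => /eqP.
Qed.

End WeightVectors.

(** * The cyclic submodule as a module *)

Section Submodule.
Context {R : nzRingType} {M : lmodType R} (P : {pred M}) (Pcl : submod_closed P).

(** The closure proof is a parameter so that the module structure is found from
    the type alone. *)
Definition submodule of submod_closed P : Type := {v : M | P v}.
Local Notation N := (submodule Pcl).

HB.instance Definition _ := GRing.isSubmodClosed.Build R M P Pcl.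
HB.instance Definition _ := SubChoice.copy N {v : M | P v}.
HB.instance Definition _ := [SubChoice_isSubLmodule of N by <:].

End Submodule.

Section CyclicSubmodule.
Context {R : nzRingType} {M : lmodType R}.

Definition cyclic_pred (v : M) : {pred M} := fun w => `[< exists u, w = u *: v >].

Lemma cyclic_submod_closed v : submod_closed (cyclic_pred v).
Proof.
split=> [|c w1 w2 /asboolP[u1 ->] /asboolP[u2 ->]]; apply/asboolP.
  by exists 0; rewrite scale0r.
by exists (c * u1 + u2); rewrite scalerDl scalerA.
Qed.

Definition cyclic v := submodule (cyclic_submod_closed v).

Definition cyclic_incl v : cyclic v -> M := val.

Lemma cyclic_incl_linear v : linear (@cyclic_incl v).
Proof. by []. Qed.
HB.instance Definition _ v :=
  GRing.isLinear.Build R (cyclic v) M *:%R (@cyclic_incl v) (@cyclic_incl_linear v).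

Lemma cyclic_incl_inj v : injective (@cyclic_incl v).
Proof. exact: val_inj. Qed.

Lemma cyclic_inclP v (w : cyclic v) : exists u, cyclic_incl w = u *: v.
Proof. by apply/asboolP; apply: (valP w). Qed.

Lemma cyclic_lift v w u : w = u *: v -> exists w' : cyclic v, cyclic_incl w' = w.
Proof.
move=> e; have h : cyclic_pred v w by apply/asboolP; exists u.
by exists (exist _ w h).
Qed.

End CyclicSubmodule.

(** * Weight vectors of a simple object *)

Section Simple.
Context {k : fieldType} {G : groupType} {chi : character k G}.
Local Notation H := (kGx chi).
Context {M : lmodType H}.
Implicit Types (lam : character k G) (u : H) (v w : M).

(** The weight components [p_i x^i v] of an element [p(x) v] of [Hv] lie in [Hv];
    independence of weight vectors is inherited from [M]. *)
Lemma cyclic_weight_module lam v :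
  weight_module M -> weight_vector lam v -> weight_module (cyclic v).
Proof.
move=> [_ Mdir] vl; split=> [w|n mu w mui wmu w0 i].
  have [u wu] := cyclic_inclP w; have [p up] := cyclic_polynomial u vl.
  rewrite up [RHS]horner_alg_sum in wu.
  have /fin_all_exists[w' w'E] (i : 'I_(size p)) : exists w' : cyclic v,
    cyclic_incl w' = kscale p`_i (xx chi ^+ i *: v).
    by apply: (cyclic_lift (u := (p`_i)%:A * xx chi ^+ i)); rewrite -[RHS]scalerA.
  exists (size p), (fun i : 'I_(size p) => char_twist lam chi i), w'; split.
    move=> i g; apply: cyclic_incl_inj; rewrite !linearZ /= w'E.
    exact: (weight_vectorZ _ (weight_xx i vl) g).
  apply: cyclic_incl_inj; rewrite wu linear_sum /=.
  by apply: eq_bigr => i _; rewrite w'E.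
apply: cyclic_incl_inj; rewrite linear0.
apply: (Mdir n mu (fun i => cyclic_incl (w i))) => //.
  by move=> j g; rewrite -linearZ /= wmu linearZ.
by rewrite -linear_sum w0 linear0.
Qed.

Lemma simple_cyclic I lam v : simple_object_W' I M -> weight_vector lam v ->
  v = 0 \/ forall w, exists u, w = u *: v.
Proof.
move=> [[MI Mw] _ Ms] vl.
have cW : in_W' I (cyclic v).
  split=> [u w Iu|]; last exact: cyclic_weight_module vl.
  by apply: cyclic_incl_inj; rewrite linearZ /= MI // linear0.
have [z|[f' _ f'K]] := Ms _ (@cyclic_incl _ _ v) cW (@cyclic_incl_inj _ _ v).
  have [v' vE] : exists v' : cyclic v, cyclic_incl v' = v.
    by apply: (cyclic_lift (u := 1)); rewrite scale1r.
  by left; rewrite -vE (z v') linear0.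
by right=> w; rewrite -(f'K w); apply: cyclic_inclP.
Qed.

(** The submodule [H(xv)] is [0] or [M], and in the second case it contains
    [v], which forces [v = 0]. *)
Lemma simple_xx0 (a : G) I lam v : chi a != 1 ->
  (forall n, (2 <= n)%N -> ~~ n.-primitive_root (char_inv chi a)) ->
  simple_object_W' I M -> weight_vector lam v -> xx chi *: v = 0.
Proof.
move=> chia noroot Ms vl.
have xl : weight_vector (char_twist lam chi 1) (xx chi *: v).
  by rewrite -[xx chi]expr1; apply: weight_xx.
have [//|/(_ v)[u vu]] := simple_cyclic Ms xl.
have [[_ Mw] _ _] := Ms.
by rewrite (weight_vector_notin_xx chia noroot Mw vl vu) scaler0.
Qed.

End Simple.

(** * The modules V_lam *)

Section OneDimensional.
Context {k : fieldType} {G : groupType} {chi : character k G}.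
Local Notation H := (kGx chi).
Implicit Types (lam mu : character k G).

Lemma Vmod_weight_vector lam (v : Vmod chi lam) : weight_vector lam v.
Proof. by move=> g; rewrite Vmod_gr Vmod_scalar. Qed.

Lemma Vmod_weight_uniq lam mu (v : Vmod chi lam) :
  weight_vector mu v -> v != 0 -> mu =1 lam.
Proof.
by move=> vmu v0 g; have := vmu g; rewrite Vmod_gr Vmod_scalar => /(mulIf v0).
Qed.

Lemma Vmod_weight_module lam : weight_module (Vmod chi lam).
Proof.
split=> [v|n mu w muI wmu w0 i].
  exists 1, (fun=> lam), (fun=> v); rewrite big_ord1; split=> // _.
  exact: Vmod_weight_vector.
(* At most one of the distinct weights can be [lam], so a nonzero [w i] is the
   only nonzero term of the sum. *)
apply: contraPeq w0 => wi0; rewrite (bigD1 i) //= big1 => [|j ji].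
  by rewrite addr0; apply/eqP.
apply: contraNeq ji => wj0; apply/eqP/muI => g.
by rewrite (Vmod_weight_uniq (wmu i) wi0) (Vmod_weight_uniq (wmu j) wj0).
Qed.

(** A nonzero value [c = f v] of an embedding [f] generates the line, so
    [w |-> (w / c) v] is inverse to [f]. *)
Lemma Vmod_simple I lam :
  (forall u, I u -> u = 0) -> simple_object_W' I (Vmod chi lam).
Proof.
move=> I0; split=> [||N f NW f_inj].
- by split=> [u v /I0 ->|]; [rewrite scale0r | exact: Vmod_weight_module].
- by exists (1 : k); apply: oner_neq0.
have [N0|/existsNP[v /eqP v0]] := pselect (forall v : N, v = 0); [by left|right].
pose c : k := f v.
have c0 : c != 0 by rewrite -(linear0 f) (inj_eq f_inj).
pose h (w : Vmod chi lam) : N := ((w : k) / c)%:A *: v.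
have fh : cancel h f.
  by move=> w; rewrite linearZ /= Vmod_scalar divfK.
by exists h => // w; apply: f_inj; rewrite fh.
Qed.

Lemma Vmod_iso_weight lam mu :
  isomorphic_modules (Vmod chi lam) (Vmod chi mu) -> lam =1 mu.
Proof.
move=> [f /bij_inj f_inj] g.
pose v : Vmod chi lam := (1 : k).
have fv0 : f v != 0 by rewrite -(linear0 f) (inj_eq f_inj) oner_neq0.
apply: (Vmod_weight_uniq _ fv0) => h.
by have := congr1 f (Vmod_weight_vector v h); rewrite !linearZ.
Qed.

Context {M : lmodType H} {lam : character k G} {v : M}.
Context (vl : weight_vector lam v) (xv0 : xx chi *: v = 0).

(** The map [c |-> c v] out of [V_lam], as soon as [v] satisfies the relations of
    its generator. *)
Definition Vmod_hom of weight_vector lam v & xx chi *: v = 0 :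
  Vmod chi lam -> M := fun c => kscale (c : k) v.
Local Notation f := (Vmod_hom vl xv0).

Lemma Vmod_hom_linear : linear f.
Proof.
have fD c d : f (c + d) = f c + f d.
  by rewrite /Vmod_hom /kscale scalerDl [LHS]scalerDl.
have fZ u c : f (u *: c) = u *: f c.
  elim/(@twAlg_ind _ (kGx_monoid chi)): u c => [|d u1 u2 e1 e2|[g i]] c.
  - by rewrite !scale0r [LHS]kscale0.
  - rewrite [_ *: c]scalerDl [RHS]scalerDl fD e2; congr (_ + _).
    rewrite [RHS]scalerZ -e1 -[d *: u1]mulr_algl -scalerA Vmod_scalar.
    by rewrite -[LHS]kscaleA.
  rewrite -gr_xxE; case: i => [|i].
    rewrite expr0 mulr1 Vmod_weight_vector Vmod_scalar.
    by rewrite [RHS]scale_kscale vl [RHS]kscaleA mulrC.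
  rewrite exprSr mulrA -[_ *: c]scalerA -[RHS]scalerA Vmod_xx scaler0.
  rewrite [X in _ = _ *: X]scale_kscale xv0 /Vmod_hom /kscale !scaler0.
  by rewrite [LHS]kscale0.
by move=> u c d; rewrite fD fZ.
Qed.
HB.instance Definition _ :=
  GRing.isLinear.Build H (Vmod chi lam) M *:%R f Vmod_hom_linear.

End OneDimensional.

(** * Classification of the simple objects *)

Lemma simple_iso_Vmod (k : fieldType) (G : groupType) (chi : character k G)
    (a : G) (I : kGx chi -> Prop) (M : lmodType (kGx chi)) : chi a != 1 ->
  (forall n, (2 <= n)%N -> ~~ n.-primitive_root (char_inv chi a)) ->
  (forall u, I u -> u = 0) ->
  simple_object_W' I M ->
  exists lam : character k G, isomorphic_modules M (Vmod chi lam).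
Proof.
move=> chia noroot I0 Ms.
have [[_ [Mdec _]] [v0 v0N] Msub] := Ms.
have [n [lam [w [wl v0E]]]] := Mdec v0.
have [i wi0] : exists i, w i != 0.
  apply/existsP; apply: contraNT v0N => /existsPn w0.
  by rewrite v0E big1 // => i _; apply/eqP; have := w0 i; rewrite negbK.
exists (lam i).
have xw0 := simple_xx0 chia noroot Ms (wl i).
pose f : {linear Vmod chi (lam i) -> M} := Vmod_hom (wl i) xw0.
have f_inj : injective f.
  move=> c d cd; apply/eqP; rewrite -subr_eq0; apply: contraNT wi0 => cd0.
  have : f (c - d) = 0 by rewrite linearB cd subrr.
  move/(congr1 (kscale (c - d : k)^-1)); rewrite [LHS]kscaleA mulVf //.
  by rewrite [LHS]kscale1 /kscale scaler0 => ->.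
have [VW _ _] := Vmod_simple (lam i) I0.
have [z|[h fh hf]] := Msub _ f VW f_inj.
  by have /eqP := z (1 : k); rewrite oner_eq0.
pose hL := GRing.isLinear.Build _ _ _ _ h (can2_linear fh hf).
pose h' : {linear M -> Vmod chi (lam i)} := HB.pack h hL.
by exists h', f.
Qed.

Lemma rank_one_ideal0 (k : fieldType) (G : groupType) (chi : character k G)
    (a : G) (I : kGx chi -> Prop) : rank_one_ideal a I ->
  (forall n, (2 <= n)%N -> ~~ n.-primitive_root (char_inv chi a)) ->
  forall u, I u -> u = 0.
Proof.
move=> + noroot.
by case=> [_ I0 u /I0//|n n2 nroot|n b n2 nroot]; have := noroot n n2; rewrite nroot.
Qed.

Theorem corollary3p15 (k : fieldType) (G : groupType) (chi : character k G)
    (a : G) (ha : forall g : G, (a * g = g * a)%g) (hchia : chi a != 1)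
    (I : kGx chi -> Prop) (hI : hopf_ideal a I) (hI1 : rank_one_ideal a I)
    (hroot : forall n : nat, (2 <= n)%N ->
       ~~ n.-primitive_root (char_inv chi a)) :
  [/\ (forall lam : character k G, simple_object_W' I (Vmod chi lam)),
      (forall lam mu : character k G,
         isomorphic_modules (Vmod chi lam) (Vmod chi mu) -> lam =1 mu)
    & (forall M : lmodType (kGx chi), simple_object_W' I M ->
         exists lam : character k G,
           isomorphic_modules M (Vmod chi lam))].
Proof.
have I0 := rank_one_ideal0 hI1 hroot; split=> [lam|lam mu|M].
- exact: Vmod_simple.
- exact: Vmod_iso_weight.
- exact: simple_iso_Vmod hchia hroot I0.
Qed.
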